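(* Let $E = C^\infty_{\mathrm{per}}(\mathbb R)$ be the Fréchet space of smooth $1$-periodic functions $\mathbb R\to\mathbb R$, let $\varphi:\mathbb R\to\mathbb R$ be a smooth function, and let $f:E\to E$ be the map $f(x)=\varphi\circ x$. Suppose that there are a set-indexed family $\boldsymbol E=(E_\iota)_{\iota\in I}$ of real locally convex spaces, indices $\mu,\nu\in I$ with $E_\mu=E_\nu=E$, and a calibration $\Gamma$ over $\boldsymbol E$ such that the map $f:E\to E$ is continuously cb $\Gamma$-differentiable $\mu\to\nu$ within $\boldsymbol E$. Then there are $\alpha,\beta\in\mathbb R$ such that $\varphi(t)=\alpha t+\beta$ for all $t\in\mathbb R$.
   Context: The space $C^\infty_{\mathrm{per}}(\mathbb R)$ consists of all smooth $x:\mathbb R\to\mathbb R$ with $x(s+1)=x(s)$ for all $s$, with the topology induced from $C^\infty(\mathbb R)$ (uniform convergence on compact sets of all derivatives); equivalently, its topology is given by the seminorms $\|x\|_i=\sup\{|D^l x(s)|: 0\le l\le i,\ s\in\mathbb R\}$, $i=0,1,2,\dots$. For a real locally convex space $F$, let $\mathcal S(F)$ be the set of all continuous seminorms on $F$. A set $N\subseteq\mathcal S(F)$ determines $F$ if for every neighbourhood $U$ of $0$ in $F$ there are $\varepsilon>0$ and a finite $N_0\subseteq N$ with $\bigcap_{p\in N_0}\{x\in F: p(x)\le\varepsilon\}\subseteq U$. Let $\boldsymbol E=(E_\iota)_{\iota\in I}$ be a family of real locally convex spaces indexed by a set $I$. A calibration over $\boldsymbol E$ is a set $\Gamma\subseteq\prod_{\iota\in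 I}\mathcal S(E_\iota)$ such that for every $\iota\in I$ the set $\{\boldsymbol p_\iota:\boldsymbol p\in\Gamma\}$ determines $E_\iota$ (where $\boldsymbol p=(\boldsymbol p_\iota)_{\iota\in I}$). Gateaux differentiability: let $G,F$ be real locally convex spaces and $g:\operatorname{dom} g\to F$ with $\operatorname{dom} g\subseteq G$. A continuous linear map $\ell:G\to F$ is the Gateaux derivative $g'(x)$ of $g$ at $x\in\operatorname{dom} g$ if $\operatorname{dom} g$ is a neighbourhood of $x$ and for every $u\in G$ one has $t^{-1}(g(x+tu)-g(x))\to\ell(u)$ in $F$ as $t\to0$, $t\in\mathbb R\setminus\{0\}$ (it is unique if $F$ is Hausdorff). The map $g$ is Gateaux differentiable if it has a Gateaux derivative at every point of $\operatorname{dom} g$. Given a calibration $\Gamma$ over $\boldsymbol E$ and $\mu,\nu\in I$, for every continuous linear $\ell:E_\mu\to E_\nu$ put $$\mathcal N(\ell)=\sup\{\boldsymbol p_\nu(\ell(v)):\boldsymbol p\in\Gamma,\ v\in E_\mu,\ \boldsymbol p_\mu(v)\le1\}\in[0,\infty],$$ and let $L$ be the vector space of those continuous linear $\ell:E_\mu\to E_\nu$ with $\mathcal N(\ell)<\infty$. Definition. A Gateaux differentiable map $g$ from (a subset of) $E_\mu$ to $E_\nu$ is continuously cb $\Gamma$-differentiable $\mu\to\nu$ within $\boldsymbol E$ if $\Gamma$ is a calibration over $\boldsymbol E$, $g'(x)\in L$ for all $x\in\operatorname{dom} g$, and for every $x\in\operatorname{dom} g$, every $\boldsymbol p\in\Gamma$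 and every $\varepsilon>0$ there is $\delta>0$ such that for all $u\in E_\mu$: if $\boldsymbol p_\mu(u)<\delta$ and $y=x+u\in\operatorname{dom} g$, then $\mathcal N(g'(y)-g'(x))<\varepsilon$. *)

(* Defs.v *)
From HB Require Import structures.
From mathcomp Require Import all_boot all_order all_algebra.
From mathcomp Require Import all_classical all_reals.
From mathcomp Require Import interval_inference topology normedtype convex.
From mathcomp Require Import ereal derive.

Set Implicit Arguments.
Unset Strict Implicit.
Unset Printing Implicit Defensive.

Import Order.TTheory GRing.Theory Num.Theory.
Import numFieldNormedType.Exports.

Local Open Scope classical_set_scope.
Local Open Scope ring_scope.

Local Notation "f ^` ()" := (derive1 f) : ring_scope.
Local Notation "f ^` ( n )" := (derive1n n f) : ring_scope.

(* A real locally convex space (not necessarily Hausdorff) is a [tvsType R],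
   which in this library includes local convexity. *)

Section LocallyConvex.
Context {R : realType}.

(* Nonnegativity and p 0 = 0 follow from the two clauses. *)
Definition is_seminorm (F : lmodType R) (p : F -> R) : Prop :=
  (forall x y, p (x + y) <= p x + p y) /\
  (forall (a : R) x, p (a *: x) = `|a| * p x).

Definition continuous_seminorm (F : tvsType R) (p : F -> R) : Prop :=
  is_seminorm p /\ continuous p.

Definition determines (F : tvsType R) (N : set (F -> R)) : Prop :=
  N `<=` [set p | continuous_seminorm p] /\
  forall U : set F, nbhs 0 U ->
    exists2 eps : R, 0 < eps &
    exists N0 : set (F -> R), [/\ finite_set N0, N0 `<=` N &
      \bigcap_(p in N0) [set x | p x <= eps] `<=` U].

Definition continuous_linear (G F : tvsType R) (l : G -> F) : Prop :=
  linear l /\ continuous l.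

(* Partial maps dom g -> F are encoded as total maps together with the set
   [D] = dom g; the values of [g] outside [D] are irrelevant, since [D] is
   required to be a neighbourhood of [x]. *)
Definition is_gateaux_derivative (G F : tvsType R) (D : set G) (g : G -> F)
    (x : G) (l : G -> F) : Prop :=
  [/\ D x, nbhs x D, continuous_linear l &
    forall u : G, t^-1 *: (g (x + t *: u) - g x) @[t --> (0 : R)^'] --> l u].

Section Family.
Context {I : Type} {E : I -> tvsType R}.

Definition calibration (Gam : set (forall i, E i -> R)) : Prop :=
  (forall p, Gam p -> forall i, continuous_seminorm (p i)) /\
  (forall i, determines [set p i | p in Gam]).

Variables (Gam : set (forall i, E i -> R)) (mu nu : I).

(* The supremum is over a set containing 0 as soon as [Gam] is a nonempty set
   of families of seminorms; for [Gam] empty it is -oo instead of 0, which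
   does not affect comparisons with positive numbers. *)
Definition cb_norm (l : E mu -> E nu) : \bar R :=
  ereal_sup [set r | exists p v,
    [/\ Gam p, p mu v <= 1 & r = (p nu (l v))%:E]].

Definition cb_maps : set (E mu -> E nu) :=
  [set l | continuous_linear l /\ (cb_norm l < +oo)%E].

(* [dg] is the Gateaux derivative x |-> g'(x); its values are unique when
   [E nu] is Hausdorff. *)
Definition continuously_cb_differentiable (D : set (E mu)) (g : E mu -> E nu)
    : Prop :=
  calibration Gam /\
  exists dg : E mu -> E mu -> E nu,
    [/\ forall x, D x -> is_gateaux_derivative D g x (dg x),
        forall x, D x -> cb_maps (dg x) &
        forall x, D x -> forall p, Gam p -> forall eps : R, 0 < eps ->
          exists2 delta : R, 0 < delta &
          forall u, p mu u < delta -> D (x + u) ->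
            (cb_norm (dg (x + u) \- dg x)%R < eps%:E)%E].

End Family.

Definition tvs_cast (F G : tvsType R) (e : F = G) : F -> G :=
  match e in _ = H return F -> H with erefl => id end.

End LocallyConvex.

Arguments continuously_cb_differentiable {R I E} Gam mu nu D g.

Section Smooth.
Context {R : realType}.
Implicit Types f g : R -> R.

Definition smooth f : Prop := forall n s, derivable (f^`(n)) s 1.

Let Ck n f := forall k, (k < n)%N -> forall s, derivable (f^`(k)) s 1.

Let smoothE f : smooth f <-> forall n, Ck n f.
Proof.
by split=> [sf n k _ s|h n s]; [exact: sf | exact: (h n.+1 n (ltnSn n) s)].
Qed.

Let CkS n f : Ck n.+1 f <-> (forall s, derivable f s 1) /\ Ck n (f^`()).
Proof.
have E k : f^`()^`(k) = f^`(k.+1) by rewrite /derive1n iterSr.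
split=> [h|[h0 h]].
  by split=> [s|k kn s]; [exact: (h 0%N) | rewrite E; exact: (h k.+1)].
by case=> [|k] kn s; [exact: h0 | rewrite -E; exact: h].
Qed.

Let CkW n f : Ck n.+1 f -> Ck n f.
Proof. by move=> h k kn; apply: h; rewrite ltnS ltnW. Qed.

Let derive1D f g : (forall s, derivable f s 1) -> (forall s, derivable g s 1) ->
  (f + g)^`() = f^`() + g^`().
Proof.
by move=> df dg; apply/funext => s; rewrite /= !fctE !derive1E deriveD.
Qed.

Let derive1Z a f : (forall s, derivable f s 1) -> (a *: f)^`() = a *: f^`().
Proof.
by move=> df; apply/funext => s; rewrite /= !fctE !derive1E (deriveZ (f := f)).
Qed.

Let derive1M f g : (forall s, derivable f s 1) -> (forall s, derivable g s 1) ->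
  (f * g)^`() = f * g^`() + g * f^`().
Proof.
by move=> df dg; apply/funext => s; rewrite /= !fctE !derive1E deriveM.
Qed.

Let CkD n f g : Ck n f -> Ck n g -> Ck n (f + g).
Proof.
elim: n f g => [//|n IH] f g /CkS[df hf] /CkS[dg hg].
apply/CkS; split=> [s|]; first exact: derivableD.
by rewrite (derive1D df dg); exact: IH.
Qed.

Let CkM n f g : Ck n f -> Ck n g -> Ck n (f * g).
Proof.
elim: n f g => [//|n IH] f g Hf Hg.
have /CkS[df hf] := Hf; have /CkS[dg hg] := Hg.
apply/CkS; split=> [s|]; first exact: derivableM.
rewrite (derive1M df dg); apply: CkD; apply: IH.
- exact: CkW Hf.
- exact: hg.
- exact: CkW Hg.
- exact: hf.
Qed.

Let Ck_comp n f g : Ck n f -> Ck n g -> Ck n (g \o f).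
Proof.
elim: n f g => [//|n IH] f g Hf Hg.
have /CkS[df hf] := Hf; have /CkS[dg hg] := Hg.
apply/CkS; split=> [s|].
  apply/derivable1_diffP; apply: differentiable_comp; exact/derivable1_diffP.
have -> : (g \o f)^`() = (g^`() \o f) * f^`().
  by apply/funext => s; rewrite /= derive1_comp.
apply: CkM; last exact: hf.
by apply: IH; [exact: CkW Hf|exact: hg].
Qed.

Lemma smooth_comp f g : smooth f -> smooth g -> smooth (g \o f).
Proof.
by move=> /smoothE sf /smoothE sg; apply/smoothE => n; exact: Ck_comp.
Qed.

Lemma derive1nD n f g : smooth f -> smooth g ->
  (f + g)^`(n) = f^`(n) + g^`(n).
Proof.
by move=> sf sg; elim: n => [//|n IH]; rewrite !derive1nS IH derive1D.
Qed.

Lemma derive1nZ n a f : smooth f -> (a *: f)^`(n) = a *: f^`(n).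
Proof. by move=> sf; elim: n => [//|n IH]; rewrite !derive1nS IH derive1Z. Qed.

Lemma derive1n_0 n : (0 : R -> R)^`(n) = 0.
Proof.
elim: n => [//|n IH]; rewrite derive1nS IH; apply/funext => s.
exact: derive1_cst.
Qed.

Lemma derive1n_periodic n f : (forall s, f (s + 1) = f s) ->
  forall s, f^`(n) (s + 1) = f^`(n) s.
Proof.
move=> pf; elim: n => [//|n IH] s; rewrite derive1nS /derive1.
set F := (X in lim (X @ _)); set G := (X in _ = lim (X @ _)).
by have -> : F = G by apply/funext => h; rewrite /F /G addrA !IH.
Qed.

Lemma continuous_periodic_bounded f : continuous f ->
  (forall s, f (s + 1) = f s) -> exists M, forall s, `|f s| <= M.
Proof.
move=> cf pf.
have pn (n : nat) s : f (s + n%:R) = f s.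
  by elim: n s => [|n IH] s; rewrite ?addr0// -addn1 natrD addrA pf IH.
have pz (z : int) s : f (s + z%:~R) = f s.
  case: z => n; first exact: pn.
  by rewrite NegzE mulrNz -(pn n.+1) -addrA addNr addr0.
have c : {within `[0, 1], continuous (fun s => `|f s|)}.
  apply: continuous_subspaceT => s.
  by apply: continuous_comp; [exact: cf | exact: norm_continuous].
have [c0 _ H] := EVT_max ler01 c.
exists `|f c0| => s; rewrite -(pz (- Num.floor s)).
apply: H; rewrite in_itv/= mulrNz subr_ge0 floor_le_tmp/= lerBlDr addrC.
by rewrite -[1]/(1%:~R) -intrD ltW// floorD1_gt.
Qed.

End Smooth.

Section Cper.
Context (R : realType).

Definition smooth_periodic : {pred (R -> R)} :=
  [pred x : R -> R | `[< smooth x /\ forall s, x (s + 1) = x s >]].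

Record cper := Cper { cper_val :> R -> R ; _ : cper_val \in smooth_periodic }.

HB.instance Definition _ := [isSub for cper_val].
HB.instance Definition _ := [Choice of cper by <:].

Lemma smooth_periodicP (x : R -> R) :
  reflect (smooth x /\ forall s, x (s + 1) = x s) (x \in smooth_periodic).
Proof. exact: asboolP. Qed.

Lemma cper_smooth (x : cper) : smooth x.
Proof. by case: x => x /= /smooth_periodicP[]. Qed.

Lemma cper_periodic (x : cper) s : x (s + 1) = x s.
Proof. by case: x => x /= /smooth_periodicP[]. Qed.

Lemma smooth_periodic_submod_closed : submod_closed smooth_periodic.
Proof.
split.
  apply/smooth_periodicP; split=> // n s.
  by rewrite derive1n_0; exact: derivable_cst.
move=> a x y /smooth_periodicP[sx px] /smooth_periodicP[sy py].
have sax : smooth (a *: x).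
  by move=> n s; rewrite derive1nZ//; apply: (derivableZ (f := x^`(n))).
apply/smooth_periodicP; split=> [n s|s].
  by rewrite derive1nD//; apply: derivableD; [exact: sax|exact: sy].
by rewrite /= !fctE px py.
Qed.

HB.instance Definition _ :=
  GRing.isSubmodClosed.Build _ _ smooth_periodic smooth_periodic_submod_closed.
HB.instance Definition _ := [SubChoice_isSubLmodule of cper by <:].

Definition cper_seminorm (i : nat) (x : cper) : R :=
  sup [set `|x^`(l) s| | l in [set l | (l <= i)%N] & s in [set: R]].

Lemma cper_derive_bounded l (x : cper) : exists M, forall s, `|x^`(l) s| <= M.
Proof.
apply: continuous_periodic_bounded => [s|s].
  by apply/differentiable_continuous/derivable1_diffP; exact: cper_smooth.
by apply: derive1n_periodic => {}s; exact: cper_periodic.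
Qed.

Lemma cper_seminorm_has_ubound i (x : cper) : has_ubound
  [set `|x^`(l) s| | l in [set l | (l <= i)%N] & s in [set: R]].
Proof.
have [M hM] := choice (fun l => cper_derive_bounded l x).
exists (\sum_(l < i.+1) M l) => _ [l /= li [s _ <-]].
apply: le_trans (hM l s) _.
rewrite (bigD1 (Ordinal (li : (l < i.+1)%N)))//= lerDl sumr_ge0// => k _.
exact: le_trans (normr_ge0 _) (hM k 0).
Qed.

Lemma le_cper_seminorm i (x : cper) l s : (l <= i)%N ->
  `|x^`(l) s| <= cper_seminorm i x.
Proof.
move=> li; apply: ub_le_sup; first exact: cper_seminorm_has_ubound.
by exists l => //; exists s.
Qed.

Lemma cper_seminorm_le i (x : cper) M :
  (forall l s, (l <= i)%N -> `|x^`(l) s| <= M) -> cper_seminorm i x <= M.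
Proof.
move=> h; apply: ge_sup; last by move=> _ [l li [s _ <-]]; exact: h.
by exists `|x^`(0) 0|, 0%N => //; exists 0.
Qed.

Lemma cper_seminorm_ge0 i x : 0 <= cper_seminorm i x.
Proof. exact: le_trans (normr_ge0 _) (le_cper_seminorm x 0 (leq0n i)). Qed.

Lemma cper_seminorm0 i : cper_seminorm i 0 = 0.
Proof.
apply/eqP; rewrite eq_le cper_seminorm_ge0 andbT.
apply: cper_seminorm_le => l s _.
by rewrite -[cper_val 0]/(0 : R -> R) derive1n_0 normr0.
Qed.

Lemma cper_seminormD i x y : cper_seminorm i (x + y) <= cper_seminorm i x + cper_seminorm i y.
Proof.
apply: cper_seminorm_le => l s li.
rewrite -[cper_val (x + y)]/(cper_val x + cper_val y).
rewrite derive1nD; [|exact: cper_smooth..].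
apply: le_trans (ler_normD _ _) _.
by apply: lerD; exact: le_cper_seminorm.
Qed.

Lemma cper_seminormZ_le i a x : cper_seminorm i (a *: x) <= `|a| * cper_seminorm i x.
Proof.
apply: cper_seminorm_le => l s li.
rewrite -[cper_val (a *: x)]/(a *: cper_val x).
rewrite derive1nZ; last exact: cper_smooth.
by rewrite normrM; apply: ler_wpM2l => //; exact: le_cper_seminorm.
Qed.

Lemma cper_seminormZ i a x : cper_seminorm i (a *: x) = `|a| * cper_seminorm i x.
Proof.
apply/eqP; rewrite eq_le cper_seminormZ_le/=.
have [->|a0] := eqVneq a 0; first by rewrite normr0 mul0r cper_seminorm_ge0.
rewrite -ler_pdivlMl ?normr_gt0// -normfV.
by rewrite -[in leLHS](scalerK a0 x) cper_seminormZ_le.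
Qed.

Lemma cper_seminormN i x : cper_seminorm i (- x) = cper_seminorm i x.
Proof. by rewrite -scaleN1r cper_seminormZ normrN1 mul1r. Qed.

Lemma cper_seminorm_mono i j x : (i <= j)%N -> cper_seminorm i x <= cper_seminorm j x.
Proof.
move=> ij; apply: cper_seminorm_le => l s li.
by apply: le_cper_seminorm; exact: leq_trans ij.
Qed.

(* The uniformity, hence the topology, defined by the seminorms [cper_seminorm i]. *)
Definition cper_entourage : set_system (cper * cper) :=
  [set A | exists i : nat, exists2 eps : R, 0 < eps &
    forall x y, cper_seminorm i (x - y) < eps -> A (x, y)].

Let cper_entourage_filter : Filter cper_entourage.
Proof.
split; first by exists 0%N, 1.
  move=> A B [i [e e0 hA]] [j [d d0 hB]].
  exists (maxn i j), (Num.min e d); first by rewrite lt_min e0.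
  move=> x y; rewrite lt_min => /andP[he hd].
  split.
    by apply: hA; exact: le_lt_trans (cper_seminorm_mono _ (leq_maxl i j)) he.
  by apply: hB; exact: le_lt_trans (cper_seminorm_mono _ (leq_maxr i j)) hd.
by move=> A B AB [i [e e0 hA]]; exists i, e => // x y /hA; exact: AB.
Qed.

Let cper_entourage_diagonal A : cper_entourage A -> diagonal `<=` A.
Proof.
move=> [i [e e0 hA]] [x y]; rewrite /diagonal/= => <-; apply: hA.
by rewrite subrr cper_seminorm0.
Qed.

Let cper_entourage_inv A : cper_entourage A -> cper_entourage A^-1%relation.
Proof.
move=> [i [e e0 hA]]; exists i, e => // x y h.
by apply: (hA y x); rewrite -opprB cper_seminormN.
Qed.

Let cper_entourage_split A : cper_entourage A ->
  exists2 B, cper_entourage B & (B \; B)%relation `<=` A.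
Proof.
move=> [i [e e0 hA]].
exists [set xy | cper_seminorm i (xy.1 - xy.2) < e / 2].
  by exists i, (e / 2) => //; rewrite divr_gt0.
move=> [x z] [y /= xy yz]; apply: hA.
rewrite -(subrKA y) [ltRHS]splitr.
by apply: le_lt_trans (cper_seminormD _ _ _) _; exact: ltrD.
Qed.

HB.instance Definition _ := isUniform.Build cper cper_entourage_filter
  cper_entourage_diagonal cper_entourage_inv cper_entourage_split.

Lemma cper_nbhsP (x : cper) (A : set cper) : nbhs x A <->
  exists i : nat, exists2 eps : R, 0 < eps &
    forall y, cper_seminorm i (x - y) < eps -> A y.
Proof.
rewrite -nbhs_entourageE; split=> [[B [i [e e0 hB]] BA]|[i [e e0 hA]]].
  by exists i, e => // y h; apply: BA; apply/xsectionP; exact: hB.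
exists [set xy | cper_seminorm i (xy.1 - xy.2) < e]; first by exists i, e.
by move=> y /xsectionP /hA.
Qed.

Let cper_add_continuous : continuous (fun x : cper * cper => x.1 + x.2).
Proof.
move=> [x y] A /cper_nbhsP[i [e e0 hA]].
exists ([set z | cper_seminorm i (x - z) < e / 2],
        [set z | cper_seminorm i (y - z) < e / 2]).
  by split; apply/cper_nbhsP; exists i, (e / 2) => //; rewrite divr_gt0.
move=> [u v] [/= hu hv]; apply: hA.
rewrite /= opprD addrACA [ltRHS]splitr.
by apply: le_lt_trans (cper_seminormD _ _ _) _; exact: ltrD.
Qed.

Let cper_scale_continuous : continuous (fun z : R^o * cper => z.1 *: z.2).
Proof.
move=> [a x] A /cper_nbhsP[i [e e0 hA]].
have x1 : 0 < cper_seminorm i x + 1 by rewrite ltr_wpDl// cper_seminorm_ge0.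
have a1 : 0 < `|a| + 1 by rewrite ltr_wpDl.
set d := Num.min 1 (e / 2 / (cper_seminorm i x + 1)).
have d0 : 0 < d by rewrite lt_min ltr01/= !divr_gt0.
exists (ball (a : R^o) d, [set z | cper_seminorm i (x - z) < e / 2 / (`|a| + 1)]).
  split; first exact: nbhsx_ballx.
  by apply/cper_nbhsP; exists i, (e / 2 / (`|a| + 1)) => //; rewrite !divr_gt0.
move=> [b y] [/= hb hy]; apply: hA => /=.
have {}hb : `|a - b| < d := hb.
have -> : a *: x - b *: y = (a - b) *: x + b *: (x - y).
  by rewrite scalerBl scalerBr subrKA.
rewrite [ltRHS]splitr; apply: le_lt_trans (cper_seminormD _ _ _) _.
rewrite !cper_seminormZ; apply: ltr_leD.
  apply: (@le_lt_trans _ _ (`|a - b| * (cper_seminorm i x + 1))).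
    by rewrite ler_wpM2l// lerDl.
  by rewrite -ltr_pdivlMr//; apply: lt_le_trans hb _; rewrite ge_min lexx orbT.
have hb' : `|b| <= `|a| + 1.
  rewrite -lerBlDl; apply: le_trans (lerB_dist _ _) _; rewrite distrC.
  by apply/ltW/(lt_le_trans hb); rewrite ge_min lexx.
apply: (@le_trans _ _ ((`|a| + 1) * cper_seminorm i (x - y))).
  by rewrite ler_wpM2r// cper_seminorm_ge0.
by rewrite mulrC -ler_pdivlMr// ltW.
Qed.

HB.instance Definition _ :=
  PreTopologicalNmodule_isTopologicalNmodule.Build cper cper_add_continuous.
HB.instance Definition _ :=
  TopologicalNmodule_isTopologicalLmodule.Build R cper cper_scale_continuous.

Let cper_locally_convex : exists2 B : set_system cper,
  (forall b, b \in B -> convex_set b) & basis B.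
Proof.
exists [set B | exists x i (e : R), B = [set y | cper_seminorm i (x - y) < e]].
  move=> _ /[!inE] -[x [i [e ->]]] y z l; rewrite !inE/= => hy hz.
  have -> : x - (l%:num *: y + (1 - l%:num) *: z) =
      l%:num *: (x - y) + (1 - l%:num) *: (x - z).
    by rewrite !scalerBr addrACA -scalerDl (addrC l%:num) subrK scale1r opprD.
  apply: le_lt_trans (cper_seminormD _ _ _) _; rewrite !cper_seminormZ.
  rewrite !ger0_norm ?subr_ge0//.
  have [->|l0] := eqVneq l%:num 0; first by rewrite mul0r add0r subr0 mul1r.
  have lp : 0 < l%:num by rewrite lt_neqAle eq_sym l0/=.
  apply: (@lt_le_trans _ _ (l%:num * e + (1 - l%:num) * e)); last first.
    by rewrite -mulrDl (addrC l%:num) subrK mul1r.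
  by apply: ltr_leD; [rewrite ltr_pM2l|rewrite ler_wpM2l ?subr_ge0// ltW].
split.
  move=> _ [x [i [e ->]]]; rewrite openE => y /= xy; apply/cper_nbhsP.
  exists i, (e - cper_seminorm i (x - y)) => [|z]; first by rewrite subr_gt0.
  rewrite ltrBrDl => h; rewrite /= -(subrKA y).
  exact: le_lt_trans (cper_seminormD _ _ _) h.
move=> x A /cper_nbhsP[i [e e0 hA]].
exists [set y | cper_seminorm i (x - y) < e]; last by move=> y /hA.
by split; [exists x, i, e|rewrite /= subrr cper_seminorm0].
Qed.

HB.instance Definition _ := Uniform_isTvs.Build R cper cper_locally_convex.

Lemma cper_comp_subproof (phi : R -> R) (sphi : smooth phi) (x : cper) :
  phi \o x \in smooth_periodic.
Proof.
apply/smooth_periodicP; split=> [|s /=]; last by rewrite cper_periodic.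
by apply: smooth_comp; [exact: cper_smooth|exact: sphi].
Qed.

Definition cper_comp (phi : R -> R) (sphi : smooth phi) (x : cper) : cper :=
  Cper (cper_comp_subproof sphi x).

End Cper.

(* Main.v *)
Require Import Defs.
From HB Require Import structures.
From mathcomp Require Import all_boot all_order all_algebra.
From mathcomp Require Import all_classical all_reals.
From mathcomp Require Import topology normedtype.
From mathcomp Require Import ereal derive realfun trigo.
From mathcomp Require Import ring lra.

Import Order.TTheory GRing.Theory Num.Theory.
Import numFieldNormedType.Exports.

Local Open Scope classical_set_scope.
Local Open Scope ring_scope.

Local Notation "f ^` ()" := (derive1 f) : ring_scope.
Local Notation "f ^` ( n )" := (derive1n n f) : ring_scope.

(** The Gateaux derivative of f at x is multiplication by phi' o x.  Fix t, one
    p in Gam, and delta for eps = 1 at the constant function t.  Applying the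
    derivatives to the constant function 1 shows that the functions
    phi' o (t + u) - phi'(t) with p_mu(u) < delta are bounded in every seminorm
    of E, while p_mu(u) < delta is already guaranteed by ||u||_k < e for some
    single k >= 1.  Test this with u(s) = a n^-k sin(2 pi n s): the resulting
    function w has period 1/n and its derivative of order k+1 is bounded by M
    independently of n, hence by Rolle |w'| <= M n^-k and w varies by at most
    M n^-(k+1) over a period.  But w takes the values 0 and
    phi'(t + a n^-k) - phi'(t), so letting n tend to infinity phi''(t) = 0. *)

(** * Calculus of smooth and periodic functions on the line *)

Section RealFunctions.
Context {R : realType}.
Implicit Types (f g : R -> R) (s t tau M : R).

Lemma smooth_derivable f s : smooth f -> derivable f s 1.
Proof. by move=> sf; exact: (sf 0%N). Qed.

Lemma smooth_derive1 f : smooth f -> smooth f^`().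
Proof. by move=> sf n s; rewrite -derive1Sn; exact: sf. Qed.

Lemma smooth_continuous f : smooth f -> continuous f.
Proof.
move=> sf s; apply/differentiable_continuous/derivable1_diffP.
exact: smooth_derivable.
Qed.

Lemma smooth_is_derive f s : smooth f -> is_derive s 1 f (f^`() s).
Proof.
by move=> sf; apply: DeriveDef; [exact: smooth_derivable|rewrite derive1E].
Qed.

Lemma smooth_MVT f s t : smooth f ->
  exists c, f t - f s = f^`() c * (t - s).
Proof.
move=> sf; wlog st : s t / s <= t.
  move=> H; have [/H//|/ltW/H[c ec]] := leP s t; exists c.
  by rewrite -opprB ec; ring.
have cf : {within `[s, t], continuous f}.
  by apply: continuous_subspaceT; exact: smooth_continuous.
have df x : x \in `]s, t[ -> is_derive x 1 f (f^`() x).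
  by move=> _; exact: smooth_is_derive.
by have [c _ ec] := MVT_segment st df cf; exists c.
Qed.

Lemma smooth_le_distM f M s t : smooth f -> (forall x, `|f^`() x| <= M) ->
  `|f t - f s| <= M * `|t - s|.
Proof.
move=> sf fM; have [c ->] := smooth_MVT f s t sf.
by rewrite normrM ler_wpM2r.
Qed.

Lemma derive1_periodic f tau : periodic f tau -> periodic f^`() tau.
Proof.
move=> pf s; rewrite /derive1.
set F := (X in lim (X @ _)); set G := (X in _ = lim (X @ _)).
by have -> : F = G by apply/funext => h; rewrite /F /G addrA !pf.
Qed.

(* By Rolle, the derivative of a tau-periodic function has a zero in every
   interval of length tau, so each differentiation costs a factor tau. *)
Lemma periodic_derive1_le f tau M j : 0 < tau -> smooth f -> periodic f tau ->
  (forall s, `|f^`(j.+1) s| <= M) -> forall s, `|f^`() s| <= tau ^+ j * M.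
Proof.
move=> tau0; elim: j f => [|j IH] f sf pf fM s; first by rewrite mul1r; exact: fM.
have f2 x : `|f^`()^`() x| <= tau ^+ j * M.
  apply: IH => [||t]; first exact: smooth_derive1.
    exact: derive1_periodic.
  by rewrite -derive1Sn; exact: fM.
have cf : {within `[s, s + tau], continuous f}.
  by apply: continuous_subspaceT; exact: smooth_continuous.
have sst : s < s + tau by rewrite ltrDl.
have df x : x \in `]s, s + tau[ -> derivable f x 1.
  by move=> _; exact: smooth_derivable.
have [c] := Rolle sst df cf (esym (pf s)); rewrite in_itv/= => /andP[sc ct] f0.
have fc0 : f^`() c = 0 by rewrite derive1E derive_val.
have := smooth_le_distM f^`() _ c s (smooth_derive1 _ sf) f2.
rewrite fc0 subr0 => /le_trans; apply.
rewrite [leRHS](_ : _ = tau ^+ j * M * tau); last by rewrite exprS; ring.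
rewrite ler_wpM2l//; first exact: le_trans (f2 0).
by rewrite distrC gtr0_norm ?subr_gt0//; lra.
Qed.

Lemma is_derive_sin_affine (a c d s : R) :
  is_derive s 1 (fun t => a * sin (c * t + d)) (a * (cos (c * s + d) * c)).
Proof.
have d1 : is_derive s 1 (fun t => c * t + d) c.
  by apply: trigger_derive; rewrite /GRing.scale/=; ring.
exact: (is_deriveZ a (@is_derive1_comp _ sin _ _ _ _ (is_derive_sin _) d1)).
Qed.

(** Each derivative stays a single sine, so that the one bound |sin| <= 1 serves all orders. *)
Lemma derive1n_sin (c : R) l :
  (fun s => sin (c * s))^`(l) = (fun s => c ^+ l * sin (c * s + pi / 2 *+ l)).
Proof.
elim: l => [|l IH].
  by apply/funext => s /=; rewrite mul1r mulr0n addr0.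
rewrite derive1nS IH; apply/funext => s; rewrite derive1E.
have d := is_derive_sin_affine (c ^+ l) c (pi / 2 *+ l) s.
by rewrite derive_val (mulrSr _ l) addrA sinDpihalf exprSr; ring.
Qed.

(** Along the steps a / n^(k+1) the difference quotient of [g] at [t] is at most C / (a n), which
    tends to 0. *)
Lemma small_increments_derive1_eq0 (g : R -> R) (t C a : R) (k : nat) :
  derivable g t 1 -> 0 < a ->
  (forall n, (0 < n)%N ->
    `|g (t + a / n%:R ^+ k.+1) - g t| <= C / n%:R ^+ k.+2) ->
  g^`() t = 0.
Proof.
move=> dg a0 hg; apply: contrapT => /eqP; rewrite -normr_gt0 => D0.
have : h^-1 *: (g (h + t) - g t) @[h --> 0^'] --> g^`() t.
  rewrite derive1E; apply: cvg_trans dg.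
  rewrite [X in X @ _ `=>` _](_ : _ =
    fun h : R => h^-1 *: ((g \o shift t) (h *: 1) - g t))//.
  by apply/funext => h; rewrite /= [h *: 1]mulr1.
have D20 : 0 < `|g^`() t| / 2 by rewrite divr_gt0.
move=> /cvgrPdist_lt/(_ _ D20)/nbhs_ballP[d /= d0 hd].
(* Large enough for both a / n^(k+1) < d and C / (a n) < |g'(t)| / 2. *)
pose n := (Num.bound (a / d) + Num.bound (C / a / (`|g^`() t| / 2))).+1.
have n0 : 0 < n%:R :> R by rewrite ltr0n.
have n1 : 1 <= n%:R :> R by rewrite ler1n.
have lt_n (x : R) : (Num.bound x <= n)%N -> x < n%:R.
  move=> xn; have [x0|/lt_trans->//] := leP 0 x.
  by rewrite (lt_le_trans (archi_boundP x0))// ler_nat.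
have nd : a / d < n%:R by apply: lt_n; rewrite leqW// leq_addr.
have nC : C / a / (`|g^`() t| / 2) < n%:R by apply: lt_n; rewrite leqW// leq_addl.
pose b := a / n%:R ^+ k.+1.
have b0 : 0 < b by rewrite divr_gt0// exprn_gt0.
have bd : b < d.
  apply: (@le_lt_trans _ _ (a / n%:R)).
    by rewrite ler_pM2l// lef_pV2 ?posrE ?exprn_gt0// exprS ler_peMr// ?exprn_ege1// ltW.
  by rewrite ltr_pdivrMr// mulrC -ltr_pdivrMr.
(* The quotient at [b] would be closer than |g'(t)| / 2 to g'(t), but [hq] bounds its absolute value
   by |g'(t)| / 2. *)
have := hd b; rewrite -ball_normE /ball_/= sub0r normrN gtr0_norm// => /(_ bd).
move=> /(_ (lt0r_neq0 b0)); rewrite ltNge => /negP; apply.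
have := hg n isT; rewrite -/b [t + b]addrC => hgn.
have hq : `|b^-1 *: (g (b + t) - g t)| <= `|g^`() t| / 2.
  rewrite normrM gtr0_norm ?invr_gt0// mulrC ler_pdivrMr//.
  apply: le_trans hgn _; rewrite ler_pdivrMr ?exprn_gt0//.
  rewrite [leRHS](_ : _ = n%:R * (`|g^`() t| / 2) * a).
    by move: nC; rewrite !ltr_pdivrMr// => /ltW.
  by rewrite /b [n%:R ^+ k.+2]exprSr; field; rewrite expf_neq0// lt0r_neq0.
rewrite [leLHS](_ : _ = `|g^`() t| - `|g^`() t| / 2); last by field.
apply: le_trans (lerB_dist _ _); exact: lerB.
Qed.

End RealFunctions.

(** * Constants, sine waves and the Gateaux derivative in E *)

Section Cper.
Context {R : realType}.
Implicit Types (x u v : cper R) (phi : R -> R).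

Lemma cper_valB x u s : (x - u) s = x s - u s. Proof. by []. Qed.
Lemma cper_valZ (a : R) x s : (a *: x) s = a * x s. Proof. by []. Qed.

Lemma cst_smooth_periodic (c : R) : cst c \in @smooth_periodic R.
Proof.
apply/smooth_periodicP; split=> // -[|n] s; first exact: derivable_cst.
have -> : (cst c : R -> R)^`(n.+1) = cst 0; last exact: derivable_cst.
rewrite derive1Sn (_ : (cst c : R -> R)^`() = 0) ?derive1n_0//.
by apply/funext => t; exact: derive1_cst.
Qed.

Definition cper_cst (c : R) : cper R := Cper (cst_smooth_periodic c).

Lemma sin_smooth_periodic (n : nat) :
  (fun s : R => sin (pi *+ 2 *+ n * s)) \in @smooth_periodic R.
Proof.
apply/smooth_periodicP; split=> [l s|s]; last first.
  by rewrite mulrDr mulr1 periodicn//; exact: sinD2pi.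
rewrite derive1n_sin.
by have [] := is_derive_sin_affine ((pi *+ 2 *+ n) ^+ l) (pi *+ 2 *+ n) (pi / 2 *+ l) s.
Qed.

Definition cper_sin (n : nat) : cper R := Cper (sin_smooth_periodic n).

(** The frequency 2 pi n is at least 1, so among the orders up to [k] the last has the largest
    amplitude. *)
Lemma cper_sin_seminorm_le k n : (0 < n)%N ->
  cper_seminorm k (cper_sin n) <= (pi *+ 2 *+ n) ^+ k.
Proof.
move=> n0; apply: cper_seminorm_le => l s lk; rewrite derive1n_sin.
have pi1 : 1 <= pi :> R by rewrite (le_trans _ (pi_ge2 R))// ler1n.
have c1 : 1 <= pi *+ 2 *+ n :> R.
  rewrite -mulrnA -mulr_natr -[leLHS]mulr1 ler_pM// ler1n muln_gt0 n0//.
rewrite normrM normrX ger0_norm ?(le_trans ler01)//.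
apply: (@le_trans _ _ ((pi *+ 2 *+ n) ^+ l * 1)).
  by rewrite ler_wpM2l ?exprn_ge0 ?(le_trans ler01)// sin_max.
by rewrite mulr1 ler_weXn2l.
Qed.

Lemma cper_eval_continuous (s : R) : continuous (fun x : cper R => x s).
Proof.
move=> x A /nbhs_ballP[e /= e0 hA]; apply/cper_nbhsP; exists 0%N, e => // y xy.
apply: hA; rewrite /ball/=; apply: le_lt_trans xy.
exact: (le_cper_seminorm (x - y) s (leqnn 0)).
Qed.

(** Evaluation at [s] is continuous on E, so the limit may be taken pointwise, where it is the
    derivative of [phi] at x(s) along v(s). *)
Lemma gateaux_cper_comp phi (sphi : smooth phi) x (l : cper R -> cper R) v s :
  is_gateaux_derivative setT (cper_comp sphi) x l -> l v s = phi^`() (x s) * v s.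
Proof.
move=> [_ _ _ /(_ v) hl].
have /(_ _) h1 := continuous_cvg _ (@cper_eval_continuous s (l v)) hl.
have df : differentiable phi (x s) by exact/derivable1_diffP/smooth_derivable.
have h2 : derivable phi (x s) (v s) by exact: diff_derivable.
have <- : 'D_(v s) phi (x s) = phi^`() (x s) * v s.
  by rewrite deriveE// diff1E// mulrC.
apply: cvg_unique h1 _; first exact: norm_hausdorff.
apply: cvg_trans h2; rewrite [X in X @ _ `=>` _](_ : _ =
  fun h : R => h^-1 *: ((phi \o shift (x s)) (h *: v s) - phi (x s)))//.
apply/funext => h; rewrite -[LHS]/(h^-1 * (phi (x s + h * v s) - phi (x s))).
by rewrite [x s + _]addrC.
Qed.

End Cper.

(** * Uniform bounds and the vanishing of phi'' *)

(** Finitely many seminorms of [N] control [q]. If [K] bounds them all on [B], scaling by e / K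
    moves [B] into the set where q < 1, so q <= K / e on [B]. *)
Lemma determines_bounded (R : realType) (F : tvsType R) (N : set (F -> R))
    (B : set F) (q : F -> R) :
  determines N -> is_seminorm q -> nbhs 0 [set x | q x < 1] ->
  (forall r, N r -> exists K, forall w, B w -> r w <= K) ->
  exists M, forall w, B w -> q w <= M.
Proof.
move=> [Nsn hN] [_ qZ] /hN[e e0 [N0 [/finite_seqP[s ->] sN0 sub]]] hB.
have [K [K0 hK]] : exists K, 0 < K /\
    forall r, r \in s -> forall w, B w -> r w <= K.
  elim: s sN0 {sub} => [|r s IH] sN0; first by exists 1.
  have [K [K0 hK]] : exists K, 0 < K /\
      forall r, r \in s -> forall w, B w -> r w <= K.
    by apply: IH => r' /= sr'; apply: sN0; rewrite /= inE sr' orbT.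
  have [L hL] := hB r (sN0 r (mem_head _ _)).
  exists (Num.max K L); split; first by rewrite lt_max K0.
  move=> r'; rewrite inE => /orP[/eqP->|/hK h] w Bw.
    by rewrite le_max hL// orbT.
  by rewrite le_max h.
exists (K / e) => w Bw; have eK0 : 0 < e / K by exact: divr_gt0.
have : q ((e / K) *: w) < 1.
  apply: sub => r /= sr; have [[_ rZ] _] := Nsn _ (sN0 _ sr).
  rewrite rZ gtr0_norm// mulrAC ler_pdivrMr// ler_wpM2l ?hK//; exact: ltW.
by rewrite qZ gtr0_norm// -ltr_pdivlMl// mulr1 invf_div => /ltW.
Qed.

(** [P] stands for the pairs (p_mu, p_nu) with p in the calibration; the last hypothesis is
    continuity of the derivative for epsilon = 1, with the supremum unfolded. *)
Lemma cb_derive2_eq0 (R : realType) (phi : R -> R) (sphi : smooth phi)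
    (P : set ((cper R -> R) * (cper R -> R)))
    (dg : cper R -> cper R -> cper R) (t : R) :
  (forall p, P p -> continuous_seminorm p.1 /\ continuous_seminorm p.2) ->
  determines [set p.2 | p in P] ->
  (forall x, is_gateaux_derivative setT (cper_comp sphi) x (dg x)) ->
  (forall x p, P p -> exists2 delta : R, 0 < delta & forall u, p.1 u < delta ->
    forall p' v, P p' -> p'.1 v <= 1 -> p'.2 (dg (x + u) v - dg x v) <= 1) ->
  phi^`()^`() t = 0.
Proof.
move=> Psn detP hdg hP.
have nbhs1 i : nbhs 0 [set x : cper R | cper_seminorm i x < 1].
  apply/cper_nbhsP; exists i, 1 => // y.
  by rewrite sub0r cper_seminormN.
(* Otherwise the finite intersection is over no seminorm and is all of E, yet the constant 1 lies
   outside the unit ball. *)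
have [p Pp] : exists p, P p.
  have [_ /(_ _ (nbhs1 0%N))[e e0 [N0 [_ sN0 sub]]]] := detP.
  apply: contrapT => nP.
  have : cper_seminorm 0 (cper_cst 1 : cper R) < 1.
    by apply: sub => r /sN0[p Pp _]; exfalso; apply: nP; exists p.
  apply/negP; rewrite -leNgt.
  apply: le_trans (le_cper_seminorm _ 0 (leqnn 0)).
  by rewrite /= normr1.
have [delta delta0 hdelta] := hP (cper_cst t) p Pp.
(* Raising the order by one makes it positive, so that the amplitudes a / n^(k+1) tend to 0. *)
have [k [e e0 hk]] : exists k : nat, exists2 e : R, 0 < e &
    forall u, cper_seminorm k.+1 u < e -> p.1 u < delta.
  have [[[_ p1Z] cp1] _] := Psn _ Pp.
  have p10 : p.1 0 = 0 by rewrite -(scale0r 0) p1Z normr0 mul0r.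
  have : nbhs (0 : cper R) (p.1 @^-1` [set r | r < delta]).
    by apply: cp1; rewrite p10; exact: lt_nbhsl.
  move=> /cper_nbhsP[i [e e0 hi]]; exists i, e => // u ue; apply: hi.
  rewrite sub0r cper_seminormN.
  exact: le_lt_trans (cper_seminorm_mono _ (leqnSn i)) ue.
pose w u := dg (cper_cst t + u) (cper_cst 1) - dg (cper_cst t) (cper_cst 1).
have wE u s : w u s = phi^`() (t + u s) - phi^`() t.
  by rewrite cper_valB !(gateaux_cper_comp _ sphi _ _ _ _ (hdg _)) !mulr1.
(* One order more than the seminorm that controls [u]: this makes the increments of phi' smaller
   than the steps by a factor of order 1/n. *)
have [M hM] : exists M, forall v, [set w u | u in [set u | p.1 u < delta]] v ->
    cper_seminorm k.+2 v <= M.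
  apply: (determines_bounded _ _ _ _ _ detP _ (nbhs1 _)).
    by split; [exact: cper_seminormD|exact: cper_seminormZ].
  move=> _ [p' Pp' <-]; have [[[_ p1Z] _] [[_ p2Z] _]] := Psn _ Pp'.
  (* The constant 1 is normalised for p'_mu; the added 1 keeps the divisor positive even where p'_mu
     vanishes. *)
  have c0 : 0 < `|p'.1 (cper_cst 1)| + 1 by rewrite ltr_wpDl.
  exists (`|p'.1 (cper_cst 1)| + 1) => _ [u /= pu <-].
  pose v : cper R := (`|p'.1 (cper_cst 1)| + 1)^-1 *: cper_cst 1.
  have v1 : p'.1 v <= 1.
    rewrite p1Z gtr0_norm ?invr_gt0// mulrC ler_pdivrMr// mul1r.
    by rewrite (le_trans (ler_norm _))// lerDl.
  have := hdelta u pu p' v Pp' v1.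
  have lin x : dg x v = (`|p'.1 (cper_cst 1)| + 1)^-1 *: dg x (cper_cst 1).
    apply/val_inj/funext => s; rewrite [RHS]cper_valZ.
    by rewrite /= !(gateaux_cper_comp _ sphi _ _ _ _ (hdg _)) mulrCA.
  rewrite !lin -scalerBr p2Z gtr0_norm ?invr_gt0// mulrC ler_pdivrMr// mul1r.
  exact.
have M0 : 0 <= M.
  apply: le_trans (hM (w 0) _); first exact: cper_seminorm_ge0.
  exists 0 => //=; apply: hk; rewrite cper_seminorm0//.
have pi20 : 0 < pi *+ 2 :> R by rewrite mulrn_wgt0// pi_gt0.
(* Chosen so that (a / n^(k+1)) (2 pi n)^(k+1) = e / 2 < e for every n > 0. *)
pose a : R := e / 2 / (pi *+ 2) ^+ k.+1.
have a0 : 0 < a by rewrite !divr_gt0// exprn_gt0.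
apply: (small_increments_derive1_eq0 _ _ M a k) => // [|n n0].
  by apply: smooth_derivable; exact: smooth_derive1.
have nR0 : 0 < n%:R :> R by rewrite ltr0n.
pose u : cper R := (a / n%:R ^+ k.+1) *: cper_sin n.
have pu : p.1 u < delta.
  apply: hk; rewrite cper_seminormZ gtr0_norm ?divr_gt0 ?exprn_gt0//.
  apply: (@le_lt_trans _ _ (a / n%:R ^+ k.+1 * (pi *+ 2 *+ n) ^+ k.+1)).
    by rewrite ler_wpM2l ?cper_sin_seminorm_le// ltW// divr_gt0// exprn_gt0.
  rewrite -[pi *+ 2 *+ n]mulr_natr exprMn /a.
  rewrite [ltLHS](_ : _ = e / 2); first by rewrite ltr_pdivrMr// ltr_pMr// ltr1n.
  by field; rewrite ?expf_neq0// ?lt0r_neq0.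
have pw : periodic (w u) n%:R^-1.
  move=> s; rewrite !wE; congr (phi^`() (t + _) - _).
  rewrite !cper_valZ; congr (_ * _); rewrite /= mulrDr.
  rewrite -[pi *+ 2 *+ n]mulr_natr -[X in _ + X]mulrA divff ?lt0r_neq0// mulr1.
  exact: sinD2pi.
(* From order k+2 down to order 1, each of the k+1 descents gains a factor 1/n. *)
have dw s : `|(w u : R -> R)^`() s| <= n%:R^-1 ^+ k.+1 * M.
  apply: periodic_derive1_le => //; [by rewrite invr_gt0|exact: cper_smooth|].
  move=> {}s; apply: le_trans (le_cper_seminorm _ s (leqnn k.+2)) _.
  by apply: hM; exists u.
(* At the quarter period 1 / (4n) the sine is 1, while at 0 it vanishes; the spare factor 1/4 is
   dropped at the end. *)
have := smooth_le_distM _ _ 0 (4^-1 / n%:R) (@cper_smooth R (w u)) dw.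
rewrite !wE !cper_valZ /= mulr0 sin0 mulr0 addr0 subrr !subr0.
rewrite [pi *+ 2 *+ n * _](_ : _ = pi / 2); last first.
  by rewrite -[pi *+ 2 *+ n]mulr_natr; field; rewrite lt0r_neq0.
rewrite sin_pihalf mulr1 => /le_trans; apply.
rewrite gtr0_norm ?divr_gt0//.
rewrite [leLHS](_ : _ = M / n%:R ^+ k.+2 * 4^-1); last first.
  by rewrite [n%:R ^+ k.+2]exprS exprVn; field; rewrite expf_neq0 ?lt0r_neq0.
by rewrite ler_piMr// ?divr_ge0 ?exprn_ge0// invf_le1// ler1n.
Qed.

(** * Affine functions and the return to the calibration *)

Lemma smooth_derive2_eq0_affine (R : realType) (f : R -> R) : smooth f ->
  (forall t, f^`()^`() t = 0) ->
  exists alpha beta : R, forall t, f t = alpha * t + beta.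
Proof.
move=> sf f0; have sf' := smooth_derive1 f sf.
have f'E t : f^`() t = f^`() 0.
  have [c] := smooth_MVT _ 0 t sf'.
  by rewrite f0 mul0r => /eqP; rewrite subr_eq0 => /eqP.
exists (f^`() 0), (f 0) => t; have [c] := smooth_MVT _ 0 t sf.
by rewrite f'E subr0 => <-; rewrite subrK.
Qed.

(* The spaces are abstracted to variables so that the casts can be eliminated. *)
Lemma cb_derive2_eq0_cast (R : realType) (phi : R -> R) (sphi : smooth phi)
    (F G : tvsType R) (eF : F = (cper R : tvsType R))
    (eG : G = (cper R : tvsType R)) (P : set ((F -> R) * (G -> R)))
    (dg : F -> F -> G) (t : R) :
  (forall p, P p -> continuous_seminorm p.1 /\ continuous_seminorm p.2) ->
  determines [set p.2 | p in P] ->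
  (forall x, is_gateaux_derivative setT
    (fun x => tvs_cast (esym eG) (cper_comp sphi (tvs_cast eF x))) x (dg x)) ->
  (forall x p, P p -> exists2 delta : R, 0 < delta & forall u, p.1 u < delta ->
    forall p' v, P p' -> p'.1 v <= 1 -> p'.2 (dg (x + u) v - dg x v) <= 1) ->
  phi^`()^`() t = 0.
Proof. by subst F G; exact: cb_derive2_eq0. Qed.

Theorem theorem11 (R : realType) (phi : R -> R) (sphi : smooth phi)
    (I : Type) (E : I -> tvsType R) (mu nu : I)
    (Emu : E mu = (cper R : tvsType R)) (Enu : E nu = (cper R : tvsType R))
    (Gam : set (forall i : I, E i -> R)) (hGam : calibration Gam)
    (hf : continuously_cb_differentiable Gam mu nu [set: E mu]
            (fun x => tvs_cast (esym Enu) (cper_comp sphi (tvs_cast Emu x)))) :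
  exists alpha beta : R, forall t : R, phi t = alpha * t + beta.
Proof.
apply: smooth_derive2_eq0_affine => // t.
have [Gsn Gdet] := hGam; have [_ [dg [hdg _ dg_cont]]] := hf.
apply: (@cb_derive2_eq0_cast R phi sphi _ _ Emu Enu
  [set (p mu, p nu) | p in Gam] dg).
- by move=> _ [p Gp <-]; split; exact: Gsn.
- by rewrite image_comp; exact: Gdet.
- by move=> x; exact: hdg.
- move=> x _ [p Gp <-]; have [delta d0 hd] := dg_cont x Logic.I p Gp 1 ltr01.
  exists delta => // u pu _ v [p' Gp' <-] p'v.
  (* The value at [v] is a member of the set whose supremum is below 1. *)
  rewrite -lee_fin; apply: le_trans (ltW (hd u pu Logic.I)).
  by apply: ereal_sup_ubound; exists p', v.
Qed.
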